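(* Fix $\ell \in \{2,3\}$. Then there are infinitely many finite insoluble groups $G$ that are not almost simple with $\delta_{\mathcal{S}}(G) = \ell$.
   Context: For a finite insoluble group $G$ with soluble radical $R(G)$ (the largest soluble normal subgroup), the soluble graph $\Gamma_{\mathcal{S}}(G)$ has vertex set $G \setminus R(G)$, with distinct vertices $x,y$ adjacent if and only if the subgroup $\langle x,y\rangle$ is soluble. Its diameter is denoted $\delta_{\mathcal{S}}(G)$ (with $\delta_{\mathcal{S}}(G)=\infty$ if the graph is disconnected). A finite group $G$ is almost simple if there is a non-abelian simple group $G_0$ with $G_0 \trianglelefteq G \leq {\rm Aut}(G_0)$. ''Infinitely many'' means up to isomorphism. *)

(* Defs.v *)
From mathcomp Require Import all_boot all_fingroup all_solvable.

Set Implicit Arguments.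
Unset Strict Implicit.
Unset Printing Implicit Defensive.

Import GroupScope.

Section GraphDiameter.

Variables (T : finType) (e : rel T).

Definition walk_of_length (x y : T) (n : nat) : bool :=
  [exists p : n.-tuple T, path e x p && (last x p == y)].

(* Least length of a walk from x to y. A shortest walk has fewer than #|T| steps,
   so searching below #|T| suffices; the value is #|T| when y is not reachable. *)
Definition graph_dist (x y : T) : nat :=
  find (walk_of_length x y) (iota 0 #|T|).

(* None stands for infinity. *)
Definition graph_diameter : option nat :=
  if [forall x, forall y, connect e x y]
  then Some (\max_(x : T) \max_(y : T) graph_dist x y)
  else None.

Lemma graph_dist_walk x y :
  connect e x y -> walk_of_length x y (graph_dist x y).
Proof.
case/connectP=> p0 e_p0 ->; case/shortenP: e_p0 => p e_p Up _.
have szp : size p < #|T| by rewrite -[(size p).+1]/(size (x :: p)) -(card_uniqP Up) max_card.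
have hw : has (walk_of_length x (last x p)) (iota 0 #|T|).
  apply/hasP; exists (size p); first by rewrite mem_iota.
  by apply/existsP; exists (in_tuple p); rewrite e_p eqxx.
have := nth_find 0 hw; rewrite nth_iota //.
by move: hw; rewrite has_find size_iota.
Qed.

Lemma graph_dist_min x y n : walk_of_length x y n -> graph_dist x y <= n.
Proof.
move=> wn; rewrite leqNgt; apply/negP=> lt_n.
have nT : n < #|T|.
  by apply: leq_trans lt_n _; rewrite -[X in _ <= X](size_iota 0) find_size.
by have := before_find 0 lt_n; rewrite nth_iota // wn.
Qed.

End GraphDiameter.

Section SolubleGraph.

Variable gT : finGroupType.
Implicit Types G H : {group gT}.

Definition soluble_radical (G : {set gT}) : {set gT} :=
  <<\bigcup_(H : {group gT} | solvable H && (H <| G)) H>>.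

Canonical soluble_radical_group G := Eval hnf in [group of soluble_radical G].

Lemma soluble_radical_max G H :
  solvable H -> H <| G -> H \subset soluble_radical G.
Proof.
by move=> sH nH; apply/sub_gen/(bigcup_max H); rewrite ?sH.
Qed.

Lemma soluble_radical_sol_normal G :
  solvable (soluble_radical G) && (soluble_radical G <| G).
Proof.
pose P (M : {group gT}) := solvable M && (M <| G).
have PY (M N : {group gT}) : P M -> P N -> P (M <*> N)%G.
  case/andP=> sM nM /andP[sN nN].
  have nNM : M \subset 'N(N) by rewrite (subset_trans (normal_sub nM)) ?normal_norm.
  rewrite /P /= normalY // andbT.
  have nNY : N <| M <*> N by rewrite /normal joing_subr join_subG nNM normG.
  rewrite (series_sol nNY) sN /= quotientYidr //.
  exact: quotient_sol.
have P1 : P 1%G by rewrite /P /= solvable1 normal1.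
have [M maxM] := ex_maxgroup (ex_intro P 1%G P1).
have [PM maxMP] := maxgroupP maxM.
suff -> : soluble_radical G = M by [].
apply/eqP; rewrite eqEsubset; apply/andP; split.
  rewrite gen_subG; apply/bigcupsP=> H PH.
  have PMH : P (M <*> H)%G by apply: PY.
  by rewrite -(maxMP _ PMH) /= ?joing_subl ?joing_subr.
by case/andP: PM => sM nM; apply: soluble_radical_max.
Qed.

Definition soluble_vertex (G : {set gT}) : finType :=
  {x : gT | x \in G :\: soluble_radical G}.

Definition soluble_adj (G : {set gT}) : rel (soluble_vertex G) :=
  fun x y => (x != y) && solvable <<[set val x; val y]>>.

Definition soluble_diameter (G : {set gT}) : option nat :=
  graph_diameter (@soluble_adj G).

End SolubleGraph.

(* G0 is identified with Inn(G0), the image of G0 in Aut(G0) under conjugation. *)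
Definition almost_simple (gT : finGroupType) (G : {group gT}) : Prop :=
  exists (hT : finGroupType) (G0 : {group hT}) (A : {group {perm hT}}),
    [/\ simple G0, ~~ abelian G0, conj_aut G0 @* G0 <| A, A \subset Aut G0
      & G \isog A].

(* Main.v *)
Require Import Defs.
From mathcomp Require Import all_boot all_fingroup all_solvable.
From mathcomp Require Import finalg zmodp.

(** The groups are [S_(l+3) x Z_(n+2)]. Their centre is not trivial, so they are
   not almost simple, and the central factor lies in the radical, so it does not
   change the diameter: it remains to see that the soluble graphs of [S_5] and
   [S_6] have diameter 2 and 3. In [S_6] every element generates a soluble
   subgroup with some involution, and two involutions generate a dihedral group,
   so the diameter is at most 3; two 5-cycles whose normalisers (of order 20)
   meet trivially have no common neighbour. In [S_5] any two elements have a
   common neighbour.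
   The finite checks rest on two certificates. If the conjugates of [a] under
   the powers of [b] commute with [a], then [<<a, b>>] is metabelian. If
   [x != 1], [x^5 = u^2 = (x u)^3 = 1], then [<<x, u>>] is not soluble, since
   its abelianisation is trivial. *)

Set Implicit Arguments.
Unset Strict Implicit.
Unset Printing Implicit Defensive.

(** * The diameter through paths of exact length *)

Section Graph.

Variables (T : finType) (e : rel T).

(** Allowing a vertex to repeat pads every walk of length at most [d] to a path of exactly [d]
    steps, so both diameter bounds concern a single length. *)
Definition reflc : rel T := fun x y => (x == y) || e x y.

Lemma walk_connect x y n : walk_of_length e x y n -> connect e x y.
Proof.
by case/existsP=> p /andP[ep /eqP <-]; apply/connectP; exists p.
Qed.

Lemma reflc_path_walk x p :
  path reflc x p -> exists2 n, n <= size p & walk_of_length e x (last x p) n.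
Proof.
elim: p x => [|y p IHp] x /=.
  by move=> _; exists 0 => //; apply/existsP; exists [tuple]; rewrite /= eqxx.
case/andP=> exy /IHp[n le_n wn]; case/orP: exy => [/eqP->|exy].
  by exists n => //; apply: leqW.
exists n.+1 => //; case/existsP: wn => q /andP[eq /eqP <-].
by apply/existsP; exists [tuple of y :: q]; rewrite /= exy eq eqxx.
Qed.

Lemma walk_reflc_path x y n d :
    walk_of_length e x y n -> n <= d ->
  exists p, [/\ size p = d, path reflc x p & last x p = y].
Proof.
case/existsP=> p /andP[ep /eqP <-] le_n.
exists (p ++ nseq (d - n) (last x p)); split.
- by rewrite size_cat size_nseq size_tuple subnKC.
- rewrite cat_path (sub_path _ ep) => [|u v euv]; last by rewrite /reflc euv orbT.
  by elim: (d - n) (last x p) => //= k IHk z; rewrite IHk /reflc eqxx.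
- by rewrite last_cat; elim: (d - n) (last x p) => //=.
Qed.

Lemma graph_diameter_eq d :
    (forall x y,
       exists p, [/\ size p = d.+1, path reflc x p & last x p = y]) ->
    (exists x y, forall p, size p = d -> path reflc x p -> last x p <> y) ->
  graph_diameter e = Some d.+1.
Proof.
move=> upper [a [b lower]].
have walk x y : exists2 n, n <= d.+1 & walk_of_length e x y n.
  by have [p [<- ep <-]] := upper x y; apply: reflc_path_walk.
have conn x y : connect e x y by have [n _ /walk_connect] := walk x y.
rewrite /graph_diameter ifT; last by apply/'forall_forallP=> x y; apply: conn.
congr Some; apply/eqP; rewrite eqn_leq; apply/andP; split.
  apply/bigmax_leqP=> x _; apply/bigmax_leqP=> y _.
  by have [n le_n /graph_dist_min/leq_trans->] := walk x y.
apply: leq_trans (leq_bigmax a); apply: leq_trans (leq_bigmax b).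
rewrite ltnNge; apply/negP=> le_d.
have [p [szp ep lp]] := walk_reflc_path (graph_dist_walk (conn a b)) le_d.
exact: lower szp ep lp.
Qed.

End Graph.

(** * Soluble and insoluble pairs; centres of almost simple groups *)

Section Solvability.

Import GroupScope.

Variable gT : finGroupType.
Implicit Types (G H : {group gT}) (a b x y : gT).

Definition solvable_pair : rel gT := fun x y => solvable <<[set x; y]>>.

Lemma solvable_pair_sub G a b :
  solvable G -> a \in G -> b \in G -> solvable_pair a b.
Proof.
by move=> solG Ga Gb; apply: solvableS solG; rewrite gen_subG subUset !sub1set Ga.
Qed.

Lemma solvable_pair_refl a : solvable_pair a a.
Proof. by rewrite /solvable_pair setUid; apply/abelian_sol/cycle_abelian. Qed.

Lemma solvable_pairC : symmetric solvable_pair.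
Proof. by move=> a b; rewrite /solvable_pair setUC. Qed.

Lemma solvable_pair1l a : solvable_pair 1 a.
Proof.
apply: solvable_pair_sub (abelian_sol (cycle_abelian a)) _ _.
  exact: group1.
exact: cycle_id.
Qed.

Lemma solvable_mul_cycle H a :
  solvable H -> a \in 'N(H) -> solvable (H <*> <[a]>).
Proof.
move=> solH nHa; have nH : <[a]> \subset 'N(H) by rewrite cycle_subG.
have nHY : H <| H <*> <[a]> by rewrite /normal joing_subl join_subG normG.
rewrite (series_sol nHY) solH /= quotientYidl //.
by apply/abelian_sol/quotient_abelian/cycle_abelian.
Qed.

(* The normal closure of [a] under [<[b]>] is abelian, with cyclic quotient. *)
Lemma solvable_pair_commute a b :
  (forall i, commute a (a ^ (b ^+ i))) -> solvable_pair a b.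
Proof.
move=> cab; pose A := <<a ^: <[b]> >>%G.
have nAb : b \in 'N(A).
  by rewrite -cycle_subG norms_gen ?class_norm.
have cAA : abelian A.
  rewrite abelian_gen; apply/centsP=> _ /imsetP[_ /cycleP[i ->] ->].
  move=> _ /imsetP[_ /cycleP[j ->] ->].
  have -> : a ^ b ^+ j = (a ^ (b ^+ j * (b ^+ i)^-1)) ^ (b ^+ i).
    by rewrite -conjgM mulgKV.
  have /cycleP[k ->] : b ^+ j * (b ^+ i)^-1 \in <[b]>.
    by rewrite groupM ?groupV ?mem_cycle.
  by rewrite /commute -!conjMg cab.
apply: (solvable_pair_sub (G := (A <*> <[b]>)%G)).
- exact: solvable_mul_cycle (abelian_sol cAA) nAb.
- by rewrite mem_gen // inE mem_gen ?class_refl.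
- by rewrite mem_gen // inE cycle_id orbT.
Qed.

(** The group is dihedral: [b] inverts [c = a * b], so each conjugate of [c] under a power of [b] is
    [c] or [c^-1] and commutes with [c]. *)
Lemma solvable_pair_involutions a b :
  a ^+ 2 = 1 -> b ^+ 2 = 1 -> solvable_pair a b.
Proof.
move=> a2 b2; pose c := a * b.
have cV : c ^ b = c^-1.
  have aV : a^-1 = a by apply/eqP; rewrite eq_invg_mul -expg2 a2.
  by rewrite invMg aV conjgE -mulgA -expg2 b2 mulg1.
have solc : solvable_pair c b.
  apply: solvable_pair_commute => i.
  suff [->|->] : c ^ b ^+ i = c \/ c ^ b ^+ i = c^-1.
  - by [].
  - by apply/commuteV.
  elim: i => [|i IHi]; first by left; rewrite conjg1.
  by rewrite expgSr conjgM; case: IHi => ->; rewrite ?conjVg cV ?invgK; auto.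
have [Hc Hb] : c \in <<[set c; b]>> /\ b \in <<[set c; b]>>.
  by split; rewrite mem_gen // !inE eqxx ?orbT.
by apply: (solvable_pair_sub solc) => //; rewrite -(mulgK b a) groupM ?groupV.
Qed.

(* Coprimality kills the images of [u] and [v] in the abelianisation of
   [<<[set u; v]>>], which is therefore perfect. *)
Lemma coprime_triple_insolvable G u v p q r :
    u \in G -> v \in G -> u != 1 ->
    coprime p q -> coprime q r -> coprime p r ->
    u ^+ p = 1 -> v ^+ q = 1 -> (u * v) ^+ r = 1 ->
  ~~ solvable G.
Proof.
move=> Gu Gv ntu co_pq co_qr co_pr up vq uvr; apply/negP=> solG.
pose H := <<[set u; v]>>%G.
have sHG : H \subset G by rewrite gen_subG subUset !sub1set Gu.
have [Hu Hv] : u \in H /\ v \in H by split; rewrite mem_gen // !inE eqxx ?orbT.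
have ntH : H :!=: 1 by apply: contraNneq ntu => H1; move: Hu; rewrite H1 inE.
have nH : H \subset 'N(H^`(1)) by apply: der_norm.
have abHb : abelian (H / H^`(1)) by apply: der_abelian.
pose cu := coset H^`(1) u; pose cv := coset H^`(1) v.
have [Nu Nv] : u \in 'N(H^`(1)) /\ v \in 'N(H^`(1)) by split; apply: (subsetP nH).
have ccuv : commute cu cv by apply: (centsP abHb); apply: mem_quotient.
have cup : cu ^+ p = 1 by rewrite /cu -morphX // up morph1.
have cvq : cv ^+ q = 1 by rewrite /cv -morphX // vq morph1.
have cuvr : (cu ^+ r) * (cv ^+ r) = 1.
  by rewrite -expgMn // /cu /cv -morphM // -morphX ?groupM // uvr morph1.
have triv (x : coset_of H^`(1)) m k : coprime m k -> x ^+ m = 1 -> x ^+ k = 1 -> x = 1.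
  move=> co_mk xm xk; have: #[x] %| gcdn m k by rewrite dvdn_gcd !order_dvdn xm xk eqxx.
  by rewrite (eqP co_mk) order_dvdn => /eqP.
have cu1 : cu = 1.
  (* The power [q] removes [cv] from the relation [cuvr], so the order of [cu] divides both [p] and
     [r * q]. *)
  apply: (triv _ p (r * q)%N) => //; first by rewrite coprimeMr co_pr.
  have cvrq : cv ^+ r ^+ q = 1 by rewrite -expgM mulnC expgM cvq expg1n.
  have: (cu ^+ r * cv ^+ r) ^+ q = 1 by rewrite cuvr expg1n.
  rewrite (expgMn _ (commuteX2 _ _ ccuv)).
  by rewrite cvrq mulg1 -expgM.
have cv1 : cv = 1.
  apply: (triv _ q r) => //.
  by move: cuvr; rewrite cu1 expg1n mul1g.
have: H^`(1) \proper H by apply: sol_der1_proper solG sHG ntH.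
rewrite properE => /andP[_ /negP[]]; rewrite gen_subG subUset !sub1set.
by rewrite (coset_idr Nu cu1) (coset_idr Nv cv1).
Qed.

(** [y] normalises the radical, and extending a soluble group by a cyclic one keeps it soluble. *)
Lemma soluble_radical_pair G x y :
  x \in soluble_radical G -> y \in G -> solvable_pair x y.
Proof.
have /andP[solR nRG] := soluble_radical_sol_normal G.
move=> Rx Gy; have nRy := subsetP (normal_norm nRG) y Gy.
apply: solvable_pair_sub (solvable_mul_cycle solR nRy) _ _.
  by rewrite mem_gen // inE Rx.
by rewrite mem_gen // inE cycle_id orbT.
Qed.

(** An automorphism commuting with all inner ones moves each element of [G0] by a central factor,
    and [G0] has trivial centre. *)
Lemma almost_simple_center G : almost_simple G -> 'Z(G) = 1.
Proof.
case=> hT [G0 [A [simG0 nabG0 nInn sA isoA]]].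
have [f injf fG] := isogP isoA.
suff ZA : 'Z(A) = 1.
  by apply/eqP; rewrite -(morphim_injm_eq1 injf) ?center_sub // injm_center // fG ZA.
have Z0 : 'Z(G0) = 1.
  have [_ /(_ _ (center_normal G0))[//|ZG]] := simpleP _ simG0.
  by case/negP: nabG0; rewrite -ZG center_abelian.
apply/trivgP/subsetP=> z /centerP[Az cz]; rewrite inE; apply/eqP.
have AutAz := subsetP sA z Az.
apply: (eq_Aut AutAz) (group1 _) _ => g G0g; rewrite perm1.
have G0z h : h \in G0 -> z h \in G0 by move=> G0h; rewrite -(autmE AutAz) Aut_closed.
have NG0 h : h \in G0 -> h \in 'N(G0) by apply: subsetP (normG G0) h.
have cgz : commute z (conj_aut G0 g).
  by apply: cz; apply: (subsetP (normal_sub nInn)); rewrite mem_morphim ?NG0.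
suff: z g * g^-1 \in 'Z(G0) by rewrite Z0 inE -eq_mulgV1 => /eqP.
apply/centerP; split=> [|h G0h]; first by rewrite groupM ?groupV ?G0z.
have [k G0k ->] : exists2 k, k \in G0 & h = z k.
  have /imsetP[k G0k ->] : h \in autm AutAz @: G0.
    by rewrite -morphimEdom ?im_autm.
  by exists k.
(* Evaluated at [k], the commutation [cgz] says that [g] and [z g] conjugate [z k] to the same
   element. *)
have := congr1 (fun s : {perm hT} => s k) cgz.
rewrite !permM !norm_conj_autE ?NG0 ?G0z // => zkg.
have zJ : z (k ^ g) = z k ^ z g := morphJ (autm_morphism AutAz) G0k G0g.
by apply/commute_sym/commgP/conjg_fixP; rewrite conjgM -zJ -zkg conjgK.
Qed.

End Solvability.

(** * Direct products with an abelian factor *)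

Section AbelianFactor.

Import GroupScope.

Variables (hT cT : finGroupType).

Hypothesis cT_abelian : abelian [set: cT].
Hypothesis trivial_radical :
  forall s : hT, s != 1 -> exists x, ~~ solvable_pair s x.

(** The kernel of the first projection is abelian, so solubility can be tested on the image. *)
Lemma solvable_pair_fst (x y : hT * cT) :
  solvable_pair x y = solvable_pair x.1 y.1.
Proof.
apply/idP/idP=> sol_xy.
  have := morphim_sol (fst_morphism hT cT) sol_xy.
  by rewrite morphim_gen ?subsetT //= morphimU !morphim_set1 ?inE.
have solX : solvable (setX <<[set x.1; y.1]>> [set: cT]).
  have dX := setX_dprod <<[set x.1; y.1]>>%G [set: cT]%G.
  have [_ nCX] := dprod_normal2 dX; rewrite (series_sol nCX).
  rewrite -(isog_sol (isog_set1X _ _)) (abelian_sol cT_abelian) /=.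
  by rewrite -(dprodW dX) quotientMidr quotient_sol // -(isog_sol (isog_setX1 _ _)).
by apply: (solvable_pair_sub solX);
  rewrite inE in_setT andbT mem_gen // !inE eqxx ?orbT.
Qed.

(** A radical element forms a soluble pair with everything, which [trivial_radical] forbids when the
    first coordinate is nontrivial. Conversely, the second factor is central. *)
Lemma fst_radical (x : hT * cT) :
  (x \in soluble_radical [set: hT * cT]%G) = (x.1 == 1).
Proof.
apply/idP/eqP=> [Rx | x1].
  have [//|/trivial_radical[y /negP[]]] := eqVneq x.1 1.
  rewrite -[y]/((y, 1 : cT).1) -solvable_pair_fst.
  by apply: soluble_radical_pair Rx _; rewrite inE.
have Zx : x \in 'Z([set: hT * cT]).
  apply/centerP; split; rewrite ?inE // => y _.
  case: x x1 y => a c /= -> [b d]; congr (_, _) => /=.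
    by rewrite mul1g mulg1.
  by apply: (centsP cT_abelian); rewrite inE.
apply: subsetP Zx; apply: soluble_radical_max (center_normal _).
exact/abelian_sol/center_abelian.
Qed.

(** In the upper bound [d] counts inner vertices, whence [d.+1] steps. Being reflexive,
    [solvable_pair] matches the reflexive closure of adjacency; vertices lift with second coordinate
    1. *)
Lemma soluble_diameter_abelian_factor d :
    (forall a b : hT, a != 1 -> b != 1 ->
       exists p, [/\ size p = d, all (predC1 1) p
                   & path (@solvable_pair hT) a (rcons p b)]) ->
    (exists a b : hT, [/\ a != 1, b != 1 &
       forall p, size p = d -> all (predC1 1) p ->
         path (@solvable_pair hT) a p -> last a p <> b]) ->
  soluble_diameter [set: hT * cT] = Some d.+1.
Proof.
move=> upper lower; set V := soluble_vertex [set: hT * cT].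
pose f (x : V) : hT := (val x).1.
have f_neq1 x : f x != 1.
  by have := valP x; rewrite inE fst_radical => /andP[].
have lift a : a != 1 -> {x : V | f x = a}.
  move=> nta; have Va : (a, 1) \in [set: hT * cT] :\: soluble_radical [set: hT * cT]%G.
    by rewrite !inE andbT fst_radical.
  by exists (Sub (a, 1) Va); rewrite /f SubK.
have reflcE x p : path (reflc (@soluble_adj _ [set: hT * cT])) x p =
                  path (@solvable_pair hT) (f x) (map f p).
  rewrite path_map; apply: eq_path => y z.
  rewrite /= -solvable_pair_fst /reflc /soluble_adj.
  by case: eqP => [->|] //=; rewrite solvable_pair_refl.
apply: graph_diameter_eq => [x y | ].
  have [p [szp ntp fp]] := upper _ _ (f_neq1 x) (f_neq1 y).
  have [q fq] : exists q, map f q = p.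
    elim: p ntp {szp fp} => [|a p IHp] /=; first by exists [::].
    by case/andP=> /lift[v <-] /IHp[q <-]; exists (v :: q).
  exists (rcons q y); rewrite size_rcons last_rcons reflcE map_rcons fq.
  by split; rewrite // -szp -fq size_map.
have [a [b [/lift[v <-] /lift[w <-] no_path]]] := lower.
exists v, w => p szp; rewrite reflcE => vp lp.
apply: no_path vp _; rewrite ?size_map ?last_map ?lp //.
by apply/allP=> _ /mapP[z _ ->]; apply: f_neq1.
Qed.

End AbelianFactor.

(** * The infinite family *)

Section CyclicFactor.

Import GroupScope.

Lemma cyclic_factor_family (hT : finGroupType) d :
    (forall s : hT, s != 1 -> exists x, ~~ solvable_pair s x) ->
    (forall a b : hT, a != 1 -> b != 1 ->
       exists p, [/\ size p = d, all (predC1 1) p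
                   & path (@solvable_pair hT) a (rcons p b)]) ->
    (exists a b : hT, [/\ a != 1, b != 1 &
       forall p, size p = d -> all (predC1 1) p ->
         path (@solvable_pair hT) a p -> last a p <> b]) ->
  exists (gT : nat -> finGroupType) (G : forall n : nat, {group (gT n)}),
    (forall n : nat,
       [/\ ~~ solvable (G n), ~ almost_simple (G n)
         & soluble_diameter (G n) = Some d.+1]) /\
    (forall m n : nat, m <> n -> ~~ isog (G m) (G n)).
Proof.
move=> trivial_radical upper lower.
have abZ n : abelian [set: 'Z_n.+2] by apply: FinRing.zmod_abelian.
(* The cyclic order [n.+2] is at least 2, so the centre is nontrivial; it also separates the members
   by cardinality. *)
exists (fun n => (hT * 'Z_n.+2)%type : finGroupType), (fun n => [set: _]%G).
split=> [n | m n neq_mn].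
  split.
  - have [a [_ [/trivial_radical[x nsol] _ _]]] := lower.
    move: nsol; rewrite -[a]/((a, 1 : 'Z_n.+2).1) -[x]/((x, 1 : 'Z_n.+2).1).
    rewrite -solvable_pair_fst ?abZ //; apply: contraNN => solG.
    by apply: solvable_pair_sub solG _ _; rewrite inE.
  - move=> /almost_simple_center Z1.
    have: (1, Zp1 : 'Z_n.+2) \in 'Z([set: hT * 'Z_n.+2]).
      apply/centerP; split; rewrite ?inE // => -[b c] _; congr (_, _) => /=.
        by rewrite mul1g mulg1.
      by apply: (centsP (abZ n)); rewrite inE.
    by rewrite Z1 => /set1P[].
  - exact: soluble_diameter_abelian_factor (abZ n) trivial_radical d upper lower.
apply: contra_notN neq_mn => /card_isog; rewrite !cardsT !card_prod !card_ord.
have hT_gt0 : 0 < #|hT| by apply/card_gt0P; exists 1.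
by move/eqP; rewrite eqn_pmul2l // => /eqP/succn_inj/succn_inj.
Qed.

End CyclicFactor.

(** * Computable certificates *)

Section Words.

Implicit Types s t : seq nat.

(* A permutation of ['I_n] is coded by the list of its values, because [{perm _}]
   does not compute. *)
Definition mulw s t := [seq nth 0 t i | i <- s].
Definition idw s := iota 0 (size s).
Definition invw s := [seq index i s | i <- idw s].
Definition expw s k := iter k (mulw s) (idw s).
Definition conjw s t := mulw (invw t) (mulw s t).

(* [k] ranges up to 6, the largest order of an element of [S_5] or [S_6]. *)
Definition commute_cert s t :=
  has (fun k => (expw t k == idw t) &&
        all (fun i => let c := conjw s (expw t i) in mulw s c == mulw c s)
          (iota 0 k))
      (iota 1 6).

(** The commuting condition treats its arguments differently, so both orders are tried. *)
Definition solvable_cert s t := commute_cert s t || commute_cert t s.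

(* Searches the words [u = s^i c^j s^k c^l] with [c = s ^ t] for one such that
   [s^5 = u^2 = (s u)^3 = 1]. *)
Definition insolvable_cert s t :=
  let powers r := [seq expw r i | i <- iota 0 5] in
  let W := [seq mulw a b | a <- powers s, b <- powers (conjw s t)] in
  [&& expw s 5 == idw s, s != idw s &
    has (fun a => has (fun b => let u := mulw a b in
      (mulw u u == idw s) && (expw (mulw s u) 3 == idw s)) W) W].

Definition nontrivial_words n :=
  [seq s <- permutations (iota 0 n) | s != iota 0 n].

End Words.

Arguments expw : simpl never.

(** * Correctness of the certificates *)

Section PermWords.

Import GroupScope.

Variable n : nat.
Implicit Types p q : 'S_n.

Definition word p : seq nat := [seq val (p i) | i <- enum 'I_n].

Lemma size_word p : size (word p) = n.
Proof. by rewrite size_map size_enum_ord. Qed.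

Lemma nth_word p (i : 'I_n) : nth 0 (word p) i = p i.
Proof. by rewrite (nth_map i) ?size_enum_ord // nth_ord_enum. Qed.

Lemma word1 : word 1 = iota 0 n.
Proof. by rewrite -val_enum_ord; apply: eq_map => i; rewrite perm1. Qed.

Lemma word_inj : injective word.
Proof.
by move=> p q eq_pq; apply/permP=> i; apply: val_inj; rewrite /= -!nth_word eq_pq.
Qed.

Lemma idw_word p : idw (word p) = word 1.
Proof. by rewrite /idw size_word word1. Qed.

Lemma mulw_word p q : mulw (word p) (word q) = word (p * q).
Proof.
rewrite /mulw -map_comp; apply: eq_map => i /=.
by rewrite nth_word permM.
Qed.

Lemma invw_word p : invw (word p) = word p^-1.
Proof.
rewrite /invw idw_word /word -map_comp; apply: eq_map => i /=.
have inj_pval : injective (fun j => val (p j)) by move=> j k /val_inj/perm_inj.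
rewrite perm1 -[in LHS](permKV p i).
by rewrite (index_map inj_pval (enum 'I_n) (p^-1 i)) index_enum_ord.
Qed.

Lemma expw_word p k : expw (word p) k = word (p ^+ k).
Proof.
rewrite /expw idw_word; elim: k => // k IHk.
by rewrite iterS IHk mulw_word expgS.
Qed.

Lemma conjw_word p q : conjw (word p) (word q) = word (p ^ q).
Proof. by rewrite /conjw invw_word !mulw_word. Qed.

Lemma eq_word p q : (word p == word q) = (p == q).
Proof. exact: inj_eq word_inj _ _. Qed.

Lemma nontrivial_word p : (word p \in nontrivial_words n) = (p != 1).
Proof.
rewrite mem_filter -word1 eq_word; case: eqP => //= _.
rewrite mem_permutations; apply: uniq_perm.
- by rewrite map_inj_uniq ?enum_uniq // => j k /val_inj/perm_inj.
- by rewrite word1 iota_uniq.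
move=> i; rewrite word1 mem_iota /= add0n; apply/mapP/idP=> [[j _ ->]|lt_i].
  exact: ltn_ord.
by exists (p^-1 (Ordinal lt_i)); rewrite ?mem_enum ?permKV.
Qed.

(** Searches return words; this recovers permutations from them. *)
Lemma nontrivial_wordP s :
  s \in nontrivial_words n -> exists2 p, p != 1 & s = word p.
Proof.
move=> Ws; have [s_n1 s_perm] : s != iota 0 n /\ perm_eq s (iota 0 n).
  by move: Ws; rewrite mem_filter mem_permutations perm_sym => /andP[].
have szs : size s = n by rewrite (perm_size s_perm) size_iota.
have s_lt (i : 'I_n) : nth 0 s i < n.
  have: nth 0 s i \in s by rewrite mem_nth ?szs.
  by rewrite (perm_mem s_perm) mem_iota.
have f_inj : injective (fun i => Ordinal (s_lt i)).
  move=> i j [/eqP]; rewrite nth_uniq ?szs ?(perm_uniq s_perm) ?iota_uniq //.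
  by move/eqP/val_inj.
have ws : s = word (perm f_inj).
  apply: (@eq_from_nth _ 0); rewrite ?size_word // szs => i lt_i.
  by rewrite -[i]/(val (Ordinal lt_i)) nth_word permE.
by exists (perm f_inj); rewrite // -nontrivial_word -ws.
Qed.

Lemma commute_certP p q :
  commute_cert (word p) (word q) -> solvable_pair p q.
Proof.
case/hasP=> k; rewrite mem_iota => /andP[k_gt0 _] /andP[].
rewrite idw_word expw_word eq_word => /eqP qk /allP cpq.
apply: solvable_pair_commute => i; rewrite -(expg_mod i qk).
have := cpq (i %% k)%N; rewrite mem_iota ltn_pmod // => /(_ isT).
by rewrite /= expw_word conjw_word !mulw_word eq_word => /eqP.
Qed.

Lemma solvable_certP p q :
  solvable_cert (word p) (word q) -> solvable_pair p q.
Proof.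
by case/orP=> /commute_certP //; rewrite solvable_pairC.
Qed.

Lemma insolvable_certP p q :
  insolvable_cert (word p) (word q) -> ~~ solvable_pair p q.
Proof.
pose H := <<[set p; q]>>%G.
have [Hp Hq] : p \in H /\ q \in H by split; rewrite mem_gen // !inE eqxx ?orbT.
rewrite /insolvable_cert conjw_word idw_word; set W := [seq _ | _ <- _, _ <- _].
(* The words searched stay inside [H], so a triple found there shows that [H] itself is
   insoluble. *)
have WH a : a \in W -> exists2 x, x \in H & a = word x.
  case/allpairsPdep=> [b [c [/mapP[i _ ->] /mapP[j _ ->] ->]]].
  exists (p ^+ i * (p ^ q) ^+ j); rewrite ?groupM ?groupX ?groupJ //.
  by rewrite !expw_word mulw_word.
rewrite expw_word !eq_word => /and3P[/eqP p5 ntp].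
case/hasP=> _ /WH[x Hx ->] /hasP[_ /WH[y Hy ->]] /=.
rewrite !mulw_word expw_word !eq_word => /andP[/eqP u2 /eqP pu3].
apply: (coprime_triple_insolvable (G := H) (u := p) (v := x * y)
          (p := 5) (q := 2) (r := 3)) => //.
by rewrite groupM.
Qed.

End PermWords.

(* Each neighbourhood is computed only once. *)
Definition common_neighbours (T : eqType) (r : rel T) (L : seq T) :=
  let nbhds := [seq [seq c <- L | r a c] | a <- L] in
  all (fun A => all (fun B => has (fun c => c \in B) A) nbhds) nbhds.

Lemma common_neighboursP (T : eqType) (r : rel T) (L : seq T) a b :
    common_neighbours r L -> a \in L -> b \in L ->
  exists c, [/\ c \in L, r a c & r b c].
Proof.
move=> /allP common La Lb.
have /allP/(_ _ (map_f _ Lb))/hasP[c] := common _ (map_f _ La).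
by rewrite !mem_filter => /andP[rac Lc] /andP[rbc _]; exists c.
Qed.

(** * The finite checks in [S_5] and [S_6] *)

Lemma sym5_words : common_neighbours solvable_cert (nontrivial_words 5).
Proof. by lazy. Qed.

(** The three 5-cycles generate distinct Sylow subgroups. [S_5] acts sharply 3-transitively on its
    six Sylow 5-subgroups, so no [s] other than the identity normalises all three. *)
Lemma sym5_insolvable_words :
  all (fun s => has (fun a => insolvable_cert a s)
         [:: [:: 1; 2; 3; 4; 0]; [:: 1; 2; 4; 0; 3]; [:: 1; 3; 4; 2; 0]])
    (nontrivial_words 5).
Proof. by lazy. Qed.

(** An element of even order has an involution among its powers; in [S_6] one of order 3 is
    centralised, and one of order 5 inverted, by an involution. *)
Lemma sym6_words :
  let L := nontrivial_words 6 in
  let I := [seq c <- L | mulw c c == idw c] in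
  all (fun a => has (solvable_cert a) I) L.
Proof. by lazy. Qed.

Lemma sym6_insolvable_words :
  all (fun s => has (fun a => insolvable_cert a s)
         [:: [:: 1; 2; 3; 4; 0; 5]; [:: 1; 2; 4; 3; 5; 0]])
    (nontrivial_words 6).
Proof. by lazy. Qed.

Section Sym.

Import GroupScope.

(** Even 5-cycles are no obstacle here: the normalisers of two distinct Sylow 5-subgroups of [S_5]
    meet in a group of order 4. *)
Lemma sym5_common_neighbour (a b : 'S_5) :
  a != 1 -> b != 1 -> exists c, [/\ c != 1, solvable_pair a c & solvable_pair c b].
Proof.
rewrite -!nontrivial_word => La Lb.
have [c [Lc ac bc]] := common_neighboursP sym5_words La Lb.
have [z ntz def_c] := nontrivial_wordP Lc.
exists z; rewrite ntz (solvable_pairC z).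
by split=> //; apply: solvable_certP; rewrite -def_c.
Qed.

Lemma sym6_involution (a : 'S_6) :
  a != 1 -> exists c, [/\ c != 1, c ^+ 2 = 1 & solvable_pair a c].
Proof.
rewrite -nontrivial_word => La.
have /allP/(_ _ La)/hasP[c] := sym6_words.
rewrite mem_filter => /andP[c2 Lc] ac; have [z ntz def_c] := nontrivial_wordP Lc.
move: c2 ac; rewrite def_c mulw_word idw_word eq_word => /eqP z2 /solvable_certP az.
by exists z.
Qed.

Lemma sym5_insolvable (s : 'S_5) : s != 1 -> exists x, ~~ solvable_pair s x.
Proof.
rewrite -nontrivial_word => /(allP sym5_insolvable_words)/hasP[a La].
have /nontrivial_wordP[x _ ->] : a \in nontrivial_words 5.
  by apply: (allP (_ : all (mem (nontrivial_words 5)) _)) La; vm_compute.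
(* The certificate takes the element of order 5 first, hence the swap. *)
by move/insolvable_certP; rewrite solvable_pairC; exists x.
Qed.

Lemma sym6_far_pair : exists a b : 'S_6, [/\ a != 1, b != 1 &
  forall c, c != 1 -> ~~ (solvable_pair a c && solvable_pair b c)].
Proof.
have /nontrivial_wordP[a nta def_a] : [:: 1; 2; 3; 4; 0; 5]%N \in nontrivial_words 6.
  by vm_compute.
have /nontrivial_wordP[b ntb def_b] : [:: 1; 2; 4; 3; 5; 0]%N \in nontrivial_words 6.
  by vm_compute.
exists a, b; split=> // c; rewrite -nontrivial_word negb_and.
move/(allP sym6_insolvable_words)/hasP=> [s]; rewrite !inE def_a def_b.
by case/orP=> /eqP-> /insolvable_certP->; rewrite ?orbT.
Qed.

Lemma sym_nontrivial n : exists s : 'S_n.+2, s != 1.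
Proof.
exists (tperm ord0 ord_max); apply/eqP=> /permP/(_ ord0).
by rewrite tpermL perm1.
Qed.

End Sym.

Theorem corollary3p4 (l : nat) (hl : l = 2 \/ l = 3) :
  exists (gT : nat -> finGroupType) (G : forall n : nat, {group (gT n)}),
    (forall n : nat,
       [/\ ~~ solvable (G n), ~ almost_simple (G n)
         & soluble_diameter (G n) = Some l]) /\
    (forall m n : nat, m <> n -> ~~ isog (G m) (G n)).
Proof.
case: hl => ->.
  apply: (@cyclic_factor_family 'S_5).
  - exact: sym5_insolvable.
  - move=> a b nta ntb; have [c [ntc ac cb]] := sym5_common_neighbour nta ntb.
    by exists [:: c]; rewrite /= ntc ac cb.
  (* Any insoluble pair is at distance more than 1. *)
  - have [a nta] := sym_nontrivial 3; have [b nab] := sym5_insolvable nta.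
    have ntb : b != 1%g.
      by apply: contraNneq nab => ->; rewrite solvable_pairC solvable_pair1l.
    exists a, b; split=> // -[|c []] //= _ _; rewrite andbT => ac cb.
    by move: nab; rewrite -cb ac.
apply: (@cyclic_factor_family 'S_6).
- have [a [b [_ _ far]]] := sym6_far_pair => s /far; rewrite negb_and.
  by case/orP; rewrite solvable_pairC; [exists a | exists b].
- move=> a b nta ntb; have [c [ntc c2 ac]] := sym6_involution nta.
  have [d [ntd d2 bd]] := sym6_involution ntb.
  (* The path runs from [a] to [b] through the involutions [c] and [d]. *)
  exists [:: c; d]; split; rewrite /= ?ntc ?ntd // ac.
  by rewrite solvable_pair_involutions // solvable_pairC bd.
have [a [b [nta ntb far]]] := sym6_far_pair.
(* A two-step path from [a] to [b] would make its middle vertex [c] a common neighbour, against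
   [far]. *)
exists a, b; split=> // -[|c [|e []]] //= _ /andP[ntc _] /and3P[ac ce _] eb.
by have := far c ntc; rewrite ac -eb solvable_pairC ce.
Qed.
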